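(* Let $k\ge2$, let $d>k-1$, and let $X=(x_1,\dots,x_n)^T\in\mathbb{R}^{n\times d}$ be a data set whose $n$ observations are partitioned into $k$ clusters of equal size $n/k$, with $T_X$ invertible. Let $Y\in\mathbb{R}^{n\times d}$ be the isotropic transformation of $X$, with the same cluster assignment. Then the structure distinctness coefficients of $X$ and $Y$ coincide: $\overline{\lambda^Y}=\overline{\lambda^X}$.
   Context: For a data matrix $W\in\mathbb{R}^{n\times d}$ with rows $w_1^T,\dots,w_n^T$ and a partition of $\{1,\dots,n\}$ into $k$ nonempty clusters of sizes $n_1,\dots,n_k$, let $\mu_W=\frac1n\sum_i w_i$ be the grand mean and $\mu_{W,l}$ the mean of the observations in cluster $l$. Total scatter matrix: $T_W=\sum_{i=1}^n(w_i-\mu_W)(w_i-\mu_W)^T$. Between-cluster scatter matrix: $B_W=\sum_{l=1}^k n_l(\mu_{W,l}-\mu_W)(\mu_{W,l}-\mu_W)^T$. Structure distinctness coefficient (when $T_W$ is invertible): $\overline{\lambda^W}=\frac{1}{k-1}\sum_{j=1}^{k-1}\lambda_j$, where $\lambda_1\ge\dots\ge\lambda_d$ are the eigenvalues, counted with multiplicity, of $T_W^{-1}B_W$ (they are real). Isotropic transformation: let $X_0$ be the centered data with rows $(x_i-\mu_X)^T$, so $T_X=X_0^TX_0$, and let $T_X=ALA^T$ be a spectral decomposition with $A$ orthogonal and $L$ diagonal with positive entries. Then $Y=X_0AL^{-1/2}$. *)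

(* Defs.v *)
From mathcomp Require Import all_boot all_order all_algebra.
From mathcomp Require Import complex polyrcf.

Set Implicit Arguments.
Unset Strict Implicit.
Unset Printing Implicit Defensive.

Import Order.TTheory GRing.Theory Num.Theory.
Local Open Scope ring_scope.

Section Scatter.
Variables (R : rcfType) (n d : nat).
Implicit Types (W X : 'M[R]_(n, d)) (P : {set {set 'I_n}}) (C : {set 'I_n}).

Definition obs W (i : 'I_n) : 'cV[R]_d := (row i W)^T.

Definition grand_mean W : 'cV[R]_d := n%:R^-1 *: \sum_(i < n) obs W i.

Definition cluster_mean W C : 'cV[R]_d := #|C|%:R^-1 *: \sum_(i in C) obs W i.

Definition total_scatter W : 'M[R]_d :=
  \sum_(i < n) (obs W i - grand_mean W) *m (obs W i - grand_mean W)^T.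

Definition between_scatter P W : 'M[R]_d :=
  \sum_(C in P) #|C|%:R *:
    ((cluster_mean W C - grand_mean W) *m (cluster_mean W C - grand_mean W)^T).

Definition centered W : 'M[R]_(n, d) :=
  \matrix_(i < n) (obs W i - grand_mean W)^T.

Definition orthogonal_mx (A : 'M[R]_d) : Prop := A *m A^T = 1%:M.

(* The diagonal of L is given as the row vector l. *)
Definition spectral_decomposition (T A : 'M[R]_d) (l : 'rV[R]_d) : Prop :=
  [/\ orthogonal_mx A, forall j, 0 < l 0 j & T = A *m diag_mx l *m A^T].

Definition isotropic X (A : 'M[R]_d) (l : 'rV[R]_d) : 'M[R]_(n, d) :=
  centered X *m A *m diag_mx (map_mx (fun a => (Num.sqrt a)^-1) l).

End Scatter.

(* rootsR lists each real root once; mup is its algebraic multiplicity. *)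
Definition eigenvalues (R : rcfType) (d : nat) (M : 'M[R]_d) : seq R :=
  let p := char_poly M in
  sort >=%R (flatten [seq nseq (mup a p) a | a <- rootsR p]).

(* The number of clusters k is #|P|.  By [size_eigenvalues] below, the list of
   eigenvalues has length d when the total scatter matrix is invertible, so that
   no default value of nth enters the sum if #|P|.-1 <= d. *)
Definition distinctness (R : rcfType) (n d : nat) (P : {set {set 'I_n}})
    (W : 'M[R]_(n, d)) : R :=
  (#|P|.-1)%:R^-1 *
  \sum_(j < #|P|.-1)
     (eigenvalues (invmx (total_scatter W) *m between_scatter P W))`_j.

Lemma eigenvaluesE (R : rcfType) (d : nat) (M : 'M[R]_d) (s : seq R) :
  char_poly M = \prod_(a <- s) ('X - a%:P) -> eigenvalues M = sort >=%R s.
Proof.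
move=> Ms; apply/perm_sortP => [x y|y x z xy yz|x y|].
- exact: le_total.
- exact: le_trans yz xy.
- by move=> h; apply/le_anti; rewrite andbC.
have p0 : char_poly M != 0 by rewrite monic_neq0 ?char_poly_monic.
have cnt (r : seq R) x : uniq r ->
    count_mem x (flatten [seq nseq (mup a (char_poly M)) a | a <- r])
      = if x \in r then mup x (char_poly M) else 0%N.
  elim: r => //= a r IH /andP[ar ur].
  rewrite count_cat IH // count_nseq /= inE [x == a]eq_sym.
  case: eqVneq => [<-|_] /=; last by rewrite mul0n.
  by rewrite (negPf ar) mul1n addn0.
apply/allP => x _ /=; rewrite cnt; last first.
  exact/(sorted_uniq lt_trans ltxx)/sorted_roots.
have /(_ x) := roots_on_rootsR p0; rewrite in_itv /= => <-.
case: ifP => [_|/negbT /mupNroot <-]; by rewrite Ms mu_prod_XsubC.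
Qed.

Section RealEigenvalues.
Variables (R : rcfType) (n d : nat) (P : {set {set 'I_n}}) (W : 'M[R]_(n, d)).
Hypothesis T_unit : total_scatter W \in unitmx.
Local Notation toC := (map_mx (real_complex R)).

Let hform (w : 'rV[R[i]]_d) (S : 'M[R]_d) : R[i] :=
  (w *m toC S *m (map_mx conjc w)^T) 0 0.

Lemma hform_outer w (v : 'cV[R]_d) :
  hform w (v *m v^T) = (w *m toC v) 0 0 * conjc ((w *m toC v) 0 0).
Proof.
rewrite /hform map_mxM mulmxA -mulmxA [in LHS]mxE big_ord1; congr (_ * _).
rewrite !mxE rmorph_sum /=; apply: eq_bigr => j _.
by rewrite !mxE rmorphM /= mulrC oppr0.
Qed.


Lemma hform_sum w (I : finType) (A : {pred I}) (F : I -> 'M[R]_d) :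
  hform w (\sum_(i in A) F i) = \sum_(i in A) hform w (F i).
Proof. by rewrite /hform raddf_sum mulmx_sumr mulmx_suml summxE. Qed.

Lemma hform_between w : 0 <= hform w (between_scatter P W).
Proof.
rewrite hform_sum sumr_ge0 // => C _; rewrite /hform map_mxZ -scalemxAr.
rewrite -scalemxAl mxE mulr_ge0 ?ler0c ?ler0n //.
by rewrite -/(hform _ _) hform_outer mulcJ_ge0.
Qed.

Lemma hform_total w : w != 0 -> 0 < hform w (total_scatter W).
Proof.
move=> w0; have -> : hform w (total_scatter W) = \sum_(i < n)
    hform w ((obs W i - grand_mean W) *m (obs W i - grand_mean W)^T).
  by rewrite /hform raddf_sum mulmx_sumr mulmx_suml summxE.
have ge0 (i : 'I_n) : true ->
    0 <= hform w ((obs W i - grand_mean W) *m (obs W i - grand_mean W)^T).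
  by rewrite hform_outer mulcJ_ge0.
rewrite lt_def sumr_ge0 // andbT psumr_neq0 //.
apply: contraNT w0 => /hasPn wT0.
have uT : toC (total_scatter W) \in unitmx by rewrite map_unitmx.
rewrite -[w](mulmxK uT) raddf_sum mulmx_sumr big1 ?mul0mx // => i _.
rewrite /= map_mxM mulmxA [w *m _]mx11_scalar.
have := wT0 i (mem_index_enum i); rewrite /= lt_def ge0 // andbT negbK.
rewrite hform_outer mulf_eq0 conjc_eq0 orbb => /eqP ->.
by rewrite raddf0 mul0mx.
Qed.

Let M := invmx (total_scatter W) *m between_scatter P W.

Lemma char_poly_eigenvalues :
  char_poly M = \prod_(a <- eigenvalues M) ('X - a%:P).
Proof.
suff [s Ms] : exists s, char_poly M = \prod_(a <- s) ('X - a%:P).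
  by rewrite (eigenvaluesE Ms) (perm_big s) ?perm_sort.
have [r] := closed_field_poly_normal (char_poly (toC M)).
rewrite (monicP (char_poly_monic _)) scale1r => Mr.
exists (map (@complex.Re R) r).
apply: (@map_poly_inj _ _ (real_complex R)).
rewrite map_char_poly Mr rmorph_prod /= big_map !big_seq.
apply: eq_bigr => z zr; rewrite rmorphB /= map_polyX map_polyC /=.
suff z_ge0 : 0 <= z.
  by congr (_ - _%:P); case: z z_ge0 {zr} => a b; rewrite lecE /= => /andP[/eqP -> _].
have /eigenvalueP[v vM v0] : eigenvalue (toC M) z.
  by rewrite eigenvalue_root_char Mr root_prod_XsubC.
have uT : toC (total_scatter W) \in unitmx by rewrite map_unitmx.
pose w := v *m invmx (toC (total_scatter W)).
have vE : v = w *m toC (total_scatter W) by rewrite mulmxKV.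
have w0 : w != 0 by apply: contraNneq v0 => w0; rewrite vE w0 mul0mx.
have : hform w (between_scatter P W) = z * hform w (total_scatter W).
  have : w *m toC (between_scatter P W) = z *: v.
    by rewrite -vM map_mxM map_invmx mulmxA.
  by rewrite /hform => ->; rewrite -vE -scalemxAl mxE.
have := hform_between w => /[swap] ->.
by rewrite pmulr_lge0 // hform_total.
Qed.

Lemma size_eigenvalues : size (eigenvalues M) = d.
Proof.
by have := size_char_poly M; rewrite char_poly_eigenvalues size_prod_XsubC => -[].
Qed.

End RealEigenvalues.

(* Main.v *)
Require Import Defs.
From mathcomp Require Import all_boot all_order all_algebra.

(* With Y = X_0 G and G = A L^{-1/2} invertible, the scatter matrices transform
   by congruence: T_Y = G^T T_X G and B_Y = G^T B_X G. Hence
   T_Y^{-1} B_Y = G^{-1} (T_X^{-1} B_X) G has the same characteristic polynomial,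
   so the same eigenvalues, as T_X^{-1} B_X. *)

Set Implicit Arguments.
Unset Strict Implicit.
Unset Printing Implicit Defensive.

Import Order.TTheory GRing.Theory Num.Theory.
Local Open Scope ring_scope.

(** Lifted to constant polynomial entries, [G] conjugates [char_poly_mx M] as a whole because
    ['X%:M] commutes with every matrix; the determinants of the two outer factors then cancel. *)
Lemma char_poly_conjmx (R : comUnitRingType) (d : nat) (G M : 'M[R]_d) :
  G \in unitmx -> char_poly (invmx G *m M *m G) = char_poly M.
Proof.
move=> uG; pose toP := map_mx (@polyC R) : 'M_d -> 'M_d.
have GG : toP (invmx G) *m toP G = 1%:M.
  by rewrite -map_mxM mulVmx // map_mx1.
rewrite /char_poly.
have -> : char_poly_mx (invmx G *m M *m G) =
          toP (invmx G) *m char_poly_mx M *m toP G.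
  rewrite /char_poly_mx mulmxBr mulmxBl !map_mxM; congr (_ - _).
  by rewrite scalar_mxC -mulmxA GG mulmx1.
by rewrite !det_mulmx mulrAC -det_mulmx GG det1 mul1r.
Qed.

Section CenteredLinearImage.
Variables (R : rcfType) (n d : nat) (W : 'M[R]_(n, d)) (G : 'M[R]_d).
Local Notation V := (centered W *m G).

Lemma obs_centered_mul i : obs V i = G^T *m (obs W i - grand_mean W).
Proof. by rewrite /obs row_mul rowK trmx_mul trmxK. Qed.

Lemma grand_mean_centered_mul : grand_mean V = 0.
Proof.
rewrite /grand_mean; under eq_bigr do rewrite obs_centered_mul.
rewrite -mulmx_sumr sumrB sumr_const card_ord -scaler_nat scalerA.
(* [n%:R] is invertible only for positive [n]; for [n = 0] the convention [0^-1 = 0] makes the mean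
   vanish. *)
case: n W => [|m] W'; first by rewrite invr0 scale0r.
by rewrite mulfV ?pnatr_eq0 // scale1r subrr mulmx0 scaler0.
Qed.

(** For empty [C] the convention [0^-1 = 0] would give [0] on the left but [- (G^T *m grand_mean W)]
    on the right. *)
Lemma cluster_mean_centered_mul (C : {set 'I_n}) : C != set0 ->
  cluster_mean V C = G^T *m (cluster_mean W C - grand_mean W).
Proof.
move=> C0; rewrite {1}/cluster_mean; under eq_bigr do rewrite obs_centered_mul.
rewrite -mulmx_sumr sumrB sumr_const -scaler_nat scalemxAr scalerBr scalerA.
by rewrite mulVf ?scale1r // pnatr_eq0 cards_eq0.
Qed.

Lemma total_scatter_centered_mul :
  total_scatter V = G^T *m total_scatter W *m G.
Proof.
rewrite /total_scatter mulmx_sumr mulmx_suml; apply: eq_bigr => i _.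
by rewrite grand_mean_centered_mul subr0 obs_centered_mul trmx_mul trmxK !mulmxA.
Qed.

Lemma between_scatter_centered_mul (P : {set {set 'I_n}}) : set0 \notin P ->
  between_scatter P V = G^T *m between_scatter P W *m G.
Proof.
move=> P0; rewrite /between_scatter mulmx_sumr mulmx_suml; apply: eq_bigr => C CP.
have C0 : C != set0 by apply: contraNneq P0 => <-.
rewrite grand_mean_centered_mul subr0 cluster_mean_centered_mul //.
by rewrite trmx_mul trmxK -scalemxAr -scalemxAl !mulmxA.
Qed.

(** [eigenvalues] depends on its matrix only through the characteristic polynomial, so similarity of
    the two matrices suffices. *)
Lemma distinctness_centered_mul (P : {set {set 'I_n}}) :
  set0 \notin P -> G \in unitmx -> total_scatter W \in unitmx ->
  distinctness P V = distinctness P W.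
Proof.
move=> P0 uG uT; rewrite /distinctness /eigenvalues.
rewrite total_scatter_centered_mul between_scatter_centered_mul //.
suff -> : invmx (G^T *m total_scatter W *m G) *m (G^T *m between_scatter P W *m G)
        = invmx G *m (invmx (total_scatter W) *m between_scatter P W) *m G.
  by rewrite char_poly_conjmx.
(* Inserting the transformed total scatter matrix and its inverse on the right avoids expanding the
   inverse of a product: [G] and [total_scatter W] then cancel against their inverses. *)
rewrite -[RHS](mulKmx (x := G^T *m total_scatter W *m G)).
  by congr (_ *m _); rewrite !mulmxA mulmxK // mulmxK.
by rewrite !unitmx_mul unitmx_tr uG uT.
Qed.

End CenteredLinearImage.

Theorem corollary3p2 (R : rcfType) (n d k : nat) (X : 'M[R]_(n, d))
    (P : {set {set 'I_n}}) (A : 'M[R]_d) (l : 'rV[R]_d) :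
  (2 <= k)%N -> (k - 1 < d)%N ->
  partition P [set: 'I_n] -> #|P| = k ->
  (forall C : {set 'I_n}, C \in P -> (k * #|C|)%N = n) ->
  total_scatter X \in unitmx ->
  spectral_decomposition (total_scatter X) A l ->
  distinctness P (isotropic X A l) = distinctness P X.
Proof.
move=> _ _ /and3P[_ _ P0] _ _ uT [AA l_gt0 _].
rewrite /isotropic -mulmxA distinctness_centered_mul //.
(* It remains to invert [G]: [A] is orthogonal, and the diagonal factor has as determinant a product
   of inverse square roots of positive numbers. *)
have [uA _] := mulmx1_unit AA.
rewrite unitmx_mul uA unitmxE det_diag unitfE.
by apply/prodf_neq0 => j _; rewrite mxE invr_neq0 // gt_eqF // sqrtr_gt0.
Qed.
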